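(* Let $p$ be a prime and $f$ a positive integer. A subgroup $H$ of $\Gamma\mathrm{L}_1(p^f)=\langle a\rangle{:}\langle\varphi\rangle$ is transitive on $\mathbb{F}_{p^f}^\times$ if and only if $H=\langle a\rangle_{\sigma'}{:}(\langle b\rangle\langle c\varphi^k\rangle)$ for some divisor $k$ of $f$, subset $\sigma$ of $\pi(p^k-1)\cap\pi(f)$, element $b$ in $\langle a\rangle_\sigma$ and generator $c$ of $\langle a\rangle_\sigma$ such that, if $2\in\sigma$ and $p^k\equiv3\pmod 4$, then $|b|_2=|a|_2/2$.
   Context: Let $\omega$ be a generator of $\mathbb{F}_{p^f}^\times$, let $a\in\mathrm{GL}_1(p^f)$ be multiplication by $\omega$, and let $\varphi$ be the Frobenius $x\mapsto x^p$ of $\mathbb{F}_{p^f}$. Then $\Gamma\mathrm{L}_1(p^f)=\langle a\rangle{:}\langle\varphi\rangle$ with $|a|=p^f-1$, $|\varphi|=f$, $a^\varphi=a^p$ (permutations act on the right), acting on $\mathbb{F}_{p^f}^\times$. For a positive integer $n$, $\pi(n)$ is its set of prime divisors; for a set $\sigma$ of primes, $n_\sigma$ is the largest divisor $\ell$ of $n$ with $\pi(\ell)\subseteq\sigma$, and $n_{\sigma'}=n/n_\sigma$. For a cyclic group $C$ of order $n$, $C_\sigma$ and $C_{\sigma'}$ are its unique subgroups of order $n_\sigma$ and $n_{\sigma'}$. When $\sigma=\{r\}$, write $r$ for the subscript $\sigma$. $|g|$ denotes the order of an element $g$, and $|g|_2$ its $2$-part. $A{:}B$ denotes an (internal) semidirect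 product with $A$ normal. *)

(* Defs.v *)
From mathcomp Require Import all_boot all_algebra all_fingroup all_solvable all_field.

Set Implicit Arguments.
Unset Strict Implicit.
Unset Printing Implicit Defensive.

Import GRing.Theory.
Local Open Scope group_scope.

(* In {perm F}, (s * t) x = t (s x) and s ^ t = t^-1 * s * t: permutations act
   on the right. *)

Section GammaL1.
Variables (F : finFieldType) (w : {unit F}) (p : nat).
Hypothesis chF : p \in [pchar F]%R.

Definition mulperm : {perm F} := perm (mulrI (valP w)).

Definition frobperm : {perm F} := perm (fmorph_inj (pFrobenius_aut chF)).

Definition GammaL1 : {group {perm F}} := (<[mulperm]> <*> <[frobperm]>)%G.

Lemma mulpermE x : mulperm x = (val w * x)%R.
Proof. exact: permE. Qed.

Lemma frobpermE x : frobperm x = (x ^+ p)%R.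
Proof. by rewrite permE. Qed.

Lemma mulpermX i x : (mulperm ^+ i) x = (val w ^+ i * x)%R.
Proof.
elim: i x => [|i IHi] x; first by rewrite perm1 mul1r.
by rewrite expgSr permM IHi mulpermE mulrA -exprS.
Qed.

Lemma mulpermJ : mulperm ^ frobperm = mulperm ^+ p.
Proof.
apply: (mulgI frobperm); rewrite -conjgC; apply/permP=> x.
by rewrite !permM mulpermX mulpermE !frobpermE exprMn.
Qed.

Lemma GammaL1_sdprod : <[mulperm]> ><| <[frobperm]> = GammaL1.
Proof.
have nAF: <[frobperm]> \subset 'N(<[mulperm]>).
  by rewrite cycle_subG; apply/normP/eqP; rewrite eqEcard cardJg leqnn andbT
             -cycleJ mulpermJ cycleX.
rewrite sdprodE //=; first by rewrite norm_joinEr.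
apply/trivgP/subsetP=> s /setIP[/cycleP[i ->] /cycleP[j e]].
have f1 : (frobperm ^+ j) 1%R = 1%R.
  by elim: j {e} => [|j IHj]; rewrite ?perm1 // expgSr permM IHj frobpermE expr1n.
have wi : (val w ^+ i = 1)%R by rewrite -[LHS]mulr1 -mulpermX e.
by rewrite inE; apply/eqP/permP=> x; rewrite mulpermX wi mul1r perm1.
Qed.

Definition GammaL1_dom : {set F} := [set x | x != 0%R].

End GammaL1.

Section CyclicPart.
Variable gT : finGroupType.

(* The subgroup of C of order #|C|`_pi; for cyclic C it exists and is unique
   (cyclic_part_unique below). The default 1 is never reached for such C. *)
Definition cyclic_part (C : {set gT}) (pi : nat_pred) : {group gT} :=
  odflt 1%G [pick K : {group gT} | (K \subset C) && (#|K| == #|C|`_pi)%N].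

Lemma cyclic_part_unique (C : {group gT}) (pi : nat_pred) (K : {group gT}) :
  cyclic C ->
  (K \subset C) && (#|K| == #|C|`_pi)%N = (K == cyclic_part C pi).
Proof.
case/cyclicP=> x defC; rewrite /cyclic_part defC.
have := cycle_sub_group (dvdn_part pi #[x]); set L := <[_]>%G => /setP defL.
have PE (M : {group gT}) :
    (M \subset <[x]>) && (#|M| == #[x]`_pi)%N = (M == L).
  by move: (defL M); rewrite !inE.
rewrite PE (eq_pick PE); case: pickP => [M /eqP-> // | /(_ L)].
by rewrite eqxx.
Qed.

End CyclicPart.

(* Main.v *)
Require Import Defs.
From mathcomp Require Import all_boot all_algebra all_fingroup all_solvable all_field.
From mathcomp Require Import zify.
Import GRing.Theory.
Local Open Scope group_scope.

(* Let d be the index of <a> :&: H in <a>, and let a^e phi^k generate H modulo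
   <a> :&: H, with l = p^k.  The n-th power of a^e phi^k maps 1 to w^(e l S_n)
   with S_n = 1 + l + ... + l^(n-1), so H is transitive iff n |-> e l S_n is
   onto Z/d.  This forces e to be coprime to d and S_n to be onto Z/d; the
   latter holds iff (Hull-Dobell) l = 1 modulo every prime divisor of d, and
   modulo 4 if 4 divides d.  Then sigma is the set of prime divisors of d, and
   (a^e phi^k)^(f/k) lies in <a> :&: H, so d divides S_(f/k), which is f/k
   modulo every prime divisor of d: these primes divide f. *)

(** * Geometric sums and their residues *)

Definition geom (l n : nat) : nat := (\sum_(i < n) l ^ i)%N.

Lemma geomS l n : geom l n.+1 = (geom l n + l ^ n)%N.
Proof. exact: big_ord_recr. Qed.

Lemma geomD l m n : geom l (m + n) = (geom l m + l ^ m * geom l n)%N.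
Proof.
rewrite /geom big_split_ord /= big_distrr /=; congr addn.
by apply: eq_bigr => i _; rewrite expnD.
Qed.

Lemma geomSl l n : geom l n.+1 = (1 + l * geom l n)%N.
Proof. by rewrite -add1n geomD expn1 /geom big_ord1 expn0. Qed.

Lemma geomM l m n : geom l (m * n) = (geom l m * geom (l ^ m) n)%N.
Proof.
elim: n => [|n IHn]; first by rewrite muln0 /geom !big_ord0 muln0.
by rewrite mulnSr geomD IHn geomS mulnDr -expnM [(l ^ _ * _)%N]mulnC.
Qed.

Lemma geom_mod1 l s n : l = 1 %[mod s] -> geom l n = n %[mod s].
Proof.
move=> l1; elim: n => [|n IHn]; first by rewrite /geom big_ord0.
by rewrite geomS -addn1 -modnDm IHn -modnXm l1 modnXm exp1n modnDm.
Qed.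

(** For odd [r], write [l = 1 + r t]: modulo [r ^ 2] the binomial expansion gives
    [l ^ i = 1 + i r t], so the sum is [r + 'C(r, 2) r t], and [r] divides ['C(r, 2)]. This fails
    for [r = 2], where [l = 1] modulo 4 is used instead. Hence [r] divides [geom l r] exactly
    once. *)
Lemma geom_prime_modX2 l r :
  prime r -> l = 1 %[mod r] -> (r = 2 -> l = 1 %[mod 4]) ->
  geom l r = r %[mod r ^ 2].
Proof.
move=> r_pr l1 l4; have [r2 | r_odd] := even_prime r_pr.
  by move: l4; rewrite r2 => /(_ erefl) l4; apply: geom_mod1.
have r_gt1 := prime_gt1 r_pr.
have l_def : l = (r * (l %/ r)).+1.
  by rewrite {1}(divn_eq l r) l1 modn_small // addn1 mulnC.
move: (l %/ r)%N l_def => t ->.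
have powE i : ((r * t).+1 ^ i = 1 + i * (r * t) %[mod r ^ 2])%N.
  elim: i => // i IHi; rewrite expnS -modnMmr IHi modnMmr.
  apply/eqP; rewrite (_ : _ * _ = i * t ^ 2 * r ^ 2 + (1 + i.+1 * (r * t)))%N.
    by rewrite modnMDl.
  by rewrite -!mulnn; nia.
have geomE n : (geom (r * t).+1 n = n + 'C(n, 2) * (r * t) %[mod r ^ 2])%N.
  elim: n => [|n IHn]; first by rewrite /geom big_ord0.
  rewrite geomS -modnDm IHn powE modnDm binS bin1; congr modn; lia.
have r_gt2 : (2 < r)%N by move: r_odd r_gt1; case: (r) => [|[|[|]]].
have /dvdnP[u binE] : (r %| 'C(r, 2))%N by apply: prime_dvd_bin.
by rewrite geomE binE addnC (_ : u * r * _ = u * t * r ^ 2)%N ?modnMDl // -mulnn; nia.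
Qed.

(** * The Hull-Dobell criterion for geometric sums *)

Lemma modn1X l m i : l = 1 %[mod m] -> l ^ i = 1 %[mod m].
Proof. by move=> l1; rewrite -modnXm l1 modnXm exp1n. Qed.

(* Hull-Dobell: x |-> l x + e is a single cycle on Z/d iff e is coprime to d and
   this condition holds. *)
Definition full_cycle_ratio (d l : nat) : Prop :=
  (forall r, prime r -> (r %| d)%N -> l = 1 %[mod r]) /\
  ((4 %| d)%N -> l = 1 %[mod 4]).

(* For d = d' r, geom l (r m) = geom l r * geom (l ^ r) m, and geom l r = u r with
   u coprime to d'; so the claim for d reduces to that for d', l ^ r and m. *)
Lemma dvdn_geom d l n :
  (0 < d)%N -> full_cycle_ratio d l -> (d %| geom l n)%N -> (d %| n)%N.
Proof.
elim/ltn_ind: d l n => d IHd l n d_gt0 [l1 l4] d_dv.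
have [d1 | d_gt1] := leqP d 1; first by rewrite (_ : d = 1)%N ?dvd1n //; lia.
have r_pr := pdiv_prime d_gt1; have r_dv := pdiv_dvd d.
move: (pdiv d) r_pr r_dv => r r_pr r_dv; have l1r := l1 r r_pr r_dv.
have r_gt1 := prime_gt1 r_pr; have r_gt0 := ltnW r_gt1.
have /dvdnP[m n_def] : (r %| n)%N.
  by rewrite /dvdn -(geom_mod1 _ _ n l1r) -/(dvdn _ _) (dvdn_trans r_dv).
have /dvdnP[d' d_def] := r_dv.
have /dvdnP[u u_def] : (r %| geom l r)%N by rewrite /dvdn (geom_mod1 _ _ r l1r) modnn.
have co_d'u : coprime d' u.
  rewrite /coprime; apply/negPn/negP=> g1.
  have g_gt1: (1 < gcdn d' u)%N.
    by rewrite ltn_neqAle eq_sym g1 gcdn_gt0; move: d_gt0; rewrite d_def; lia.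
  have s_pr := pdiv_prime g_gt1; have := pdiv_dvd (gcdn d' u).
  move: (pdiv _) s_pr => s s_pr; rewrite dvdn_gcd => /andP[sd' su].
  have sd : (s %| d)%N by rewrite d_def dvdn_mulr.
  (* Modulo a common prime [s] of [d'] and [u], the sum [geom l r] is both 0 and [r], so [s = r]. *)
  have /eqP := geom_mod1 l s r (l1 s s_pr sd).
  rewrite u_def -modnMml (eqP su) mul0n mod0n eq_sym -/(dvdn s r) dvdn_prime2 //.
  move=> /eqP sr; subst s.
  have l4r : r = 2 -> l = 1 %[mod 4].
    by move=> r2; apply: l4; rewrite d_def r2 (@dvdn_mul 2 2) // -r2.
  (* Now [r] divides [u], so [r ^ 2] divides [geom l r], against its residue [r] modulo [r ^ 2]. *)
  have := geom_prime_modX2 l r r_pr l1r l4r.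
  have /dvdnP[v v_def] := su.
  rewrite u_def v_def -mulnA mulnn modnMl modn_small; first by move: r_gt0; lia.
  by rewrite -{1}(expn1 r) ltn_exp2l.
rewrite d_def n_def dvdn_pmul2r //.
move: d_dv; rewrite n_def mulnC geomM u_def d_def mulnAC dvdn_pmul2r // Gauss_dvdr //.
have d'_gt0 : (0 < d')%N by move: d_gt0; rewrite d_def; lia.
apply: IHd => //; first by rewrite d_def ltn_Pmulr.
split=> [s s_pr sd' | d4]; apply: modn1X; last by apply: l4; rewrite d_def dvdn_mulr.
by apply: l1; rewrite // d_def dvdn_mulr.
Qed.

Lemma coprime_full_cycle_ratio d l :
  (0 < d)%N -> full_cycle_ratio d l -> coprime d l.
Proof.
move=> d_gt0 [l1 _]; rewrite /coprime; apply/negPn/negP => g1.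
have g_gt1: (1 < gcdn d l)%N by rewrite ltn_neqAle eq_sym g1 gcdn_gt0 d_gt0.
have s_pr := pdiv_prime g_gt1; have := pdiv_dvd (gcdn d l).
move: (pdiv _) s_pr => s s_pr; rewrite dvdn_gcd => /andP[sd sl].
by have := l1 s s_pr sd; rewrite (eqP sl) modn_small ?prime_gt1.
Qed.

(** On the finite set of residues, injectivity suffices. If the sums at [m <= n] agree modulo [d],
    then [d] divides [l ^ m * geom l (n - m)]; as [l] is coprime to [d], [dvdn_geom] makes [d]
    divide [n - m]. *)
Lemma geom_surj d l t :
  (0 < d)%N -> full_cycle_ratio d l -> exists n, geom l n = t %[mod d].
Proof.
case: d => // d _ dl.
have inj : injective (fun n : 'I_d.+1 => inord (geom l n %% d.+1) : 'I_d.+1).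
  suff wlog_inj (m n : nat) : (m <= n < d.+1)%N ->
      geom l m = geom l n %[mod d.+1] -> m = n.
    move=> m n /(congr1 val) /=; rewrite !inordK ?ltn_mod // => e.
    apply: val_inj => /=; case/orP: (leq_total m n) => le; last symmetry.
      by apply: wlog_inj; rewrite ?le ?ltn_ord.
    by apply: wlog_inj; rewrite ?le ?ltn_ord.
  case/andP=> le_mn lt_nd /esym/eqP.
  rewrite -{1}(subnKC le_mn) geomD -{2}[geom l m]addn0 eqn_modDl mod0n -/(dvdn _ _).
  rewrite Gauss_dvdr ?coprimeXr ?coprime_full_cycle_ratio // => /dvdn_geom.
  move=> /(_ isT dl) dv; have := modn_small (leq_ltn_trans (leq_subr m n) lt_nd).
  by rewrite (eqP dv); lia.
have [g _ fK] := injF_bij inj; exists (g (inord (t %% d.+1))).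
by have /(congr1 val) /= := fK (inord (t %% d.+1)); rewrite !inordK ?ltn_mod.
Qed.

(** Since [l ^ n = 1 + (l - 1) * geom l n], if [l - 1] were invertible modulo a prime [r] of [d], a
    sum equal to the inverse of [1 - l] would make [r] divide [l ^ n]. If [4] divides [d] and
    [l = 3] modulo 4, the sums alternate between 0 and 1 modulo 4 and miss 2. *)
Lemma geom_surj_inv d l :
  (0 < l)%N -> coprime d l -> (forall t, exists n, geom l n = t %[mod d]) ->
  full_cycle_ratio d l.
Proof.
move=> l_gt0 co_dl surj.
have surj_dv s t : (s %| d)%N -> exists n, geom l n = t %[mod s].
  by have [n e] := surj t => sd; exists n; rewrite -(modn_dvdm _ sd) e modn_dvdm.
split=> [r r_pr rd | d4].
  have r_gt1 := prime_gt1 r_pr; have r_gt0 := ltnW r_gt1.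
  apply/eqP; rewrite eqn_mod_dvd //; apply/negPn/negP=> rNl.
  have /coprimeP : coprime r (l - 1) by rewrite prime_coprime.
  case/(_ r_gt0)=> -[u v] /= uv; have [n nE] := surj_dv r v rd.
  have rl : (r %| l ^ n)%N.
    rewrite -(prednK (_ : 0 < l ^ n)%N) ?expn_gt0 ?l_gt0 // predn_exp -/(geom l n).
    rewrite -subn1 -addn1 /dvdn -modnDml -modnMmr nE modnMmr modnDml.
    rewrite mulnC (_ : _ + _ = u * r)%N ?modnMl //.
    by move: (_ * _)%N (_ * _)%N uv => ? ?; lia.
  have := coprime_dvdl rd co_dl; rewrite prime_coprime //.
  by move: rl; rewrite Euclid_dvdX // => /andP[->].
have l_odd : odd l by rewrite -coprime2n; apply: coprime_dvdl co_dl; apply: dvdn_trans d4.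
apply/eqP; apply/negPn/negP=> l1.
have l3 : l = 3 %[mod 4] by lia.
suff geom4 n : (geom l n %% 4 = odd n)%N.
  by have [n] := surj_dv 4 2 d4; rewrite geom4; case: (odd n).
elim: n => [|n IHn]; first by rewrite /geom big_ord0.
have powE : (l ^ n %% 4 = if odd n then 3 else 1)%N.
  rewrite -modnXm l3; elim: n {IHn} => // n IHn.
  by rewrite expnS -modnMmr IHn /=; case: (odd n).
by rewrite geomS -modnDm IHn powE /=; case: (odd n).
Qed.

(** * Auxiliary arithmetic of residues and parts *)

Lemma modn_mulI d c x y :
  coprime d c -> (c * x = c * y %[mod d])%N -> x = y %[mod d].
Proof.
move=> co_dc; wlog le_yx : x y / (y <= x)%N.
  by case/orP: (leq_total y x) => le IH e; [|symmetry]; apply: IH.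
move/eqP; rewrite eqn_mod_dvd ?leq_mul2l ?le_yx ?orbT // -mulnBr Gauss_dvdr //.
by rewrite -eqn_mod_dvd // => /eqP.
Qed.

Lemma partn_dvd_div N d : (0 < d)%N -> (d %| N)%N -> (N`_\pi(d)^' %| N %/ d)%N.
Proof.
move=> d_gt0 dN; rewrite dvdn_divRL // Gauss_dvd ?dvdn_part //.
by rewrite coprime_sym (pnat_coprime (pnat_pi d_gt0)) ?part_pnat.
Qed.

Lemma odd_mod4 l : l = 1 %[mod 2] -> l != 1 %[mod 4] -> l = 3 %[mod 4].
Proof. lia. Qed.

Lemma half_mul4_ndvd x t : (0 < x)%N -> (0 < t * 4)%N -> ~~ (x * (t * 4) %/ 2 %| x)%N.
Proof.
move=> x_gt0 t_gt0; rewrite (_ : x * (t * 4) = x * t * 2 * 2)%N ?mulnK //; last lia.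
by apply/negP=> /(dvdn_leq x_gt0); nia.
Qed.

(** * Cyclic groups and their Hall subgroups *)

Lemma sub_cycleX (gT : finGroupType) (a : gT) (K : {group gT}) :
  K \subset <[a]> -> exists2 d, (d %| #[a])%N & K :=: <[a ^+ d]>.
Proof.
move=> sKa; have dvK := cardSg sKa.
exists (#[a] %/ #|K|)%N; first exact: dvdn_div.
have := cycle_sub_group dvK => /setP/(_ K).
by rewrite !inE sKa eqxx => /esym/eqP/(congr1 val).
Qed.

Lemma mulgX_rcoset (gT : finGroupType) (K : {group gT}) (c g : gT) n :
  c \in K -> g \in 'N(K) -> exists2 u, u \in K & (c * g) ^+ n = u * g ^+ n.
Proof.
move=> Kc Ng; elim: n => [|n [u Ku IHn]].
  by exists 1; rewrite ?group1 // !expg0 mulg1.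
exists (c * u ^ g^-1); first by rewrite groupM // memJ_norm ?groupV.
by rewrite expgS IHn expgS conjgE invgK !mulgA mulgKV.
Qed.

Section CyclicPartTheory.
Variables (gT : finGroupType) (C : {group gT}) (pi : nat_pred).
Hypothesis cycC : cyclic C.

Lemma cyclic_partP :
  (cyclic_part C pi \subset C) /\ #|cyclic_part C pi| = (#|C|`_pi)%N.
Proof.
have := @cyclic_part_unique gT C pi (cyclic_part C pi) cycC.
by rewrite eqxx => /andP[-> /eqP->].
Qed.

Lemma constt_cyclic_part x : x \in C -> x.`_pi \in cyclic_part C pi.
Proof.
have [sKC cardK] := cyclic_partP => Cx.
have Cxpi : x.`_pi \in C by apply: subsetP (cycle_constt pi x); rewrite cycle_subG.
rewrite -cycle_subG -(cardSg_cyclic cycC) ?cycle_subG //.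
by rewrite cardK -orderE order_constt partn_dvd ?cardG_gt0 ?order_dvdG.
Qed.

Lemma cyclic_part_norm (G : {group gT}) : C <| G -> G \subset 'N(cyclic_part C pi).
Proof.
have [sKC _] := cyclic_partP => nCG.
by apply/normal_norm/(char_normal_trans _ nCG); rewrite sub_cyclic_char.
Qed.

End CyclicPartTheory.

(** The order of [a] is [gcdn #[a] e * #[a ^+ e]]. The first factor is coprime to [d], hence to
    every prime in [sigma], so the whole [sigma]-part of [#[a]] divides [#[a ^+ e]]. *)
Lemma generator_constt_part (gT : finGroupType) (a : gT) (sigma : nat_pred) d e :
    (0 < d)%N -> sigma =i \pi(d) -> coprime d e ->
    a ^+ e \in cyclic_part <[a]> sigma ->
  generator (cyclic_part <[a]> sigma) (a ^+ e).
Proof.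
move=> d_gt0 sd co_de Ac; rewrite /generator eq_sym eqEcard cycle_subG Ac /=.
have [_ ->] := cyclic_partP _ [group of <[a]>] sigma (cycle_cyclic a).
rewrite -!orderE; apply: dvdn_leq; first exact: order_gt0.
have dvN : (#[a]`_sigma %| gcdn #[a] e * #[a ^+ e])%N.
  by rewrite orderXgcd mulnC divnK ?dvdn_gcdl // dvdn_part.
rewrite Gauss_dvdr // in dvN; apply: (pnat_coprime (part_pnat _ _)).
rewrite (eq_pnat _ (eq_negn sd)) -coprime_pi' ?gcdn_gt0 ?order_gt0 //.
exact: coprime_dvdr (dvdn_gcdr _ _) co_de.
Qed.

(** * The orbit of 1 and the index of the multiplication subgroup *)

Section GammaL1Theory.
Variables (F : finFieldType) (w : {unit F}) (p : nat) (chF : p \in [pchar F]%R).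
Local Notation a := (mulperm w).
Local Notation phi := (frobperm chF).
Local Notation A := <[a]>.
Local Notation Gam := (GammaL1 w chF).

Lemma mulpermX1 i : (a ^+ i) 1%R = val (w ^+ i).
Proof. by rewrite mulpermX mulr1 FinRing.val_unitX. Qed.

Lemma order_mulperm : #[a] = #[w].
Proof.
have aw n : (a ^+ n == 1) = (w ^+ n == 1).
  apply/eqP/eqP=> e.
    by apply: val_inj; rewrite -mulpermX1 e perm1.
  by apply/permP=> x; rewrite mulpermX -FinRing.val_unitX e mul1r perm1.
by apply/eqP; rewrite eqn_dvd !order_dvdn aw expg_order -aw expg_order !eqxx.
Qed.

Lemma frobpermX j x : (phi ^+ j) x = (x ^+ (p ^ j))%R.
Proof.
elim: j x => [|j IHj] x; first by rewrite perm1 expr1.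
by rewrite expgSr permM IHj frobpermE -exprM expnSr.
Qed.

(** Permutations act on the right: each factor multiplies by [w ^+ e] first and then raises to the
    power [p ^ k]. Exponents of [w] thus follow [x |-> p ^ k * (e + x)], whence the extra factor
    [p ^ k] outside the sum. *)
Lemma mulfrobX1 e k n :
  ((a ^+ e * phi ^+ k) ^+ n) 1%R = val (w ^+ (e * (p ^ k * geom (p ^ k) n))).
Proof.
elim: n => [|n IHn]; first by rewrite perm1 /geom big_ord0 !muln0.
rewrite expgSr permM IHn permM mulpermX frobpermX geomSl !FinRing.val_unitX.
by rewrite -exprD -exprM; congr (_ ^+ _)%R; lia.
Qed.

Lemma mulperm_normal : A <| Gam.
Proof. by have /sdprod_context[] := GammaL1_sdprod w chF. Qed.

Lemma frobX_GammaL1 k : phi ^+ k \in Gam.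
Proof. by rewrite groupX // mem_gen // inE cycle_id orbT. Qed.

Lemma mulperm_frob_TI : A :&: <[phi]> = 1.
Proof. by have /sdprod_context[] := GammaL1_sdprod w chF. Qed.

Lemma GammaL1_0 g : g \in Gam -> g 0%R = 0%R.
Proof.
suff /subsetP sGC : Gam \subset 'C[0%R | 'P] by move/sGC/astab1P.
rewrite join_subG !cycle_subG; apply/andP; split; apply/astab1P => /=.
  by rewrite apermE mulpermE mulr0.
by rewrite apermE frobpermE expr0n -(prednK (prime_gt0 (pcharf_prime chF))).
Qed.

Hypothesis gen_w : generator [set: {unit F}] w.

Lemma order_gen : #[w] = #|F|.-1.
Proof. by rewrite -card_finField_unit orderE; move/eqP: gen_w => <-. Qed.

(** The group fixes 0, and the nonzero elements are the powers of [w]; it remains to reach each of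
    them from 1. *)
Lemma transitive_GammaL1P (H : {group {perm F}}) : H \subset Gam ->
  reflect (forall i, exists2 h : {perm F}, h \in H & h 1%R = val (w ^+ i))
          [transitive H, on GammaL1_dom F | 'P].
Proof.
move=> sHG; have dom1 : 1%R \in GammaL1_dom F by rewrite inE oner_neq0.
apply: (iffP idP) => [trH i | surjH].
  have domw : val (w ^+ i) \in GammaL1_dom F.
    by rewrite inE -unitfE (valP (w ^+ i)).
  by have [h Hh ->] := atransP2 trH dom1 domw; exists h.
apply/imsetP; exists 1%R => //; apply/setP=> x; rewrite inE.
apply/idP/orbitP=> [x0 | [h Hh <-]] /=.
  have [i xE] : exists i, x = val (w ^+ i).
    have ux : (x \is a GRing.unit)%R by rewrite unitfE.
    have : FinRing.unit F ux \in <[w]>.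
      by move/eqP: gen_w => <-; rewrite inE.
    by case/cycleP=> i e; exists i; rewrite -e.
  by have [h Hh h1] := surjH i; exists h; rewrite // /aperm h1.
rewrite /aperm; apply/eqP=> h0; have := GammaL1_0 _ (subsetP sHG _ Hh).
by rewrite -{2}h0 => /perm_inj/esym/eqP; rewrite oner_eq0.
Qed.

Variables (f : nat) (H : {group {perm F}}) (d e k : nat).
Hypotheses (cardF : #|F| = (p ^ f)%N) (sHG : H \subset Gam).
Hypotheses (d_dv : (d %| #[a])%N) (defAH : A :&: H = <[a ^+ d]>).
Hypothesis Hg : a ^+ e * phi ^+ k \in H.

Let p_pr : prime p := pcharf_prime chF.

Let d_gt0 : (0 < d)%N := dvdn_gt0 (order_gt0 a) d_dv.

Lemma coprime_index_char : (0 < f)%N -> coprime d p.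
Proof.
move=> f_gt0; apply: coprime_dvdl d_dv _.
rewrite order_mulperm order_gen cardF coprime_sym prime_coprime //.
apply/negP=> dv; have := dvdn_exp f_gt0 (dvdnn p).
rewrite -(prednK (_ : 0 < p ^ f)%N) ?expn_gt0 ?prime_gt0 // -addn1 dvdn_addr //.
by rewrite dvdn1; have := prime_gt1 p_pr; lia.
Qed.

Lemma unit_gen_mod i j : val (w ^+ i) = val (w ^+ j) -> i = j %[mod d].
Proof.
move/val_inj/eqP; rewrite eq_expg_mod_order -order_mulperm => /eqP ij.
by rewrite -(modn_dvdm i d_dv) ij modn_dvdm.
Qed.

Lemma transitive_of_full_cycle :
    (0 < f)%N -> coprime d e -> full_cycle_ratio d (p ^ k) ->
  [transitive H, on GammaL1_dom F | 'P].
Proof.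
move=> f_gt0 co_de dl; apply/transitive_GammaL1P => // i.
have co_de' : coprime d (e * p ^ k).
  by rewrite coprimeMr co_de coprimeXr ?coprime_index_char.
(* By Euler's theorem this power is an inverse of [e * p ^ k] modulo [d]. *)
have vE : (e * p ^ k * (e * p ^ k) ^ (totient d).-1 = 1 %[mod d])%N.
  by rewrite -expnS prednK ?totient_gt0 // Euler_exp_totient // coprime_sym.
move: (_ ^ (totient d).-1)%N vE => v vE.
have [n nE] := geom_surj d (p ^ k) (v * i) d_gt0 dl.
set s := (e * (p ^ k * geom (p ^ k) n))%N.
have sE : s = i %[mod d].
  by rewrite /s mulnA -modnMmr nE modnMmr mulnA -modnMml vE modnMml mul1n.
(* Adding [#[a] * s] to the target exponent [i] changes neither [w ^+ i] nor the class modulo [d],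
   and lets [s] be subtracted in the naturals. *)
have le_s : (s <= i + #[a] * s)%N.
  by apply: leq_trans (leq_addl _ _); rewrite leq_pmull.
have /dvdnP[m mE] : (d %| i + #[a] * s - s)%N.
  rewrite -eqn_mod_dvd // sE -modnDmr.
  by have /eqP-> : (d %| #[a] * s)%N; rewrite ?addn0 // dvdn_mulr.
exists ((a ^+ e * phi ^+ k) ^+ n * (a ^+ d) ^+ m).
  have sdH : <[a ^+ d]> \subset H by rewrite -defAH subsetIr.
  by apply: groupM; [exact: groupX | apply: (subsetP sdH); exact: mem_cycle].
rewrite permM mulfrobX1 -/s -expgM mulpermX -FinRing.val_unitX.
rewrite -FinRing.val_unitM -expgD mulnC -mE subnK // expgD expgM.
by rewrite order_mulperm expg_order expg1n mulg1.
Qed.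

Lemma transitive_full_cycle :
    (forall h, h \in H -> exists n, exists2 y, y \in <[a ^+ d]> &
      h = (a ^+ e * phi ^+ k) ^+ n * y) ->
  [transitive H, on GammaL1_dom F | 'P] ->
  coprime d e /\ full_cycle_ratio d (p ^ k).
Proof.
move=> genH /(transitive_GammaL1P _ sHG) surjH.
have surj i : exists n, (e * (p ^ k * geom (p ^ k) n) = i %[mod d])%N.
  have [h /genH[n [y /cycleP[m ->] ->]]] := surjH i.
  rewrite permM mulfrobX1 -expgM mulpermX -FinRing.val_unitX -FinRing.val_unitM.
  by rewrite -expgD => /unit_gen_mod; rewrite mulnC modnMDl => nE; exists n.
(* Reaching the exponent 1 shows that [e * p ^ k] is invertible modulo [d]. *)
have co_d : coprime d (e * p ^ k).
  have [n nE] := surj 1%N; apply: (@coprime_dvdr _ (e * (p ^ k * geom (p ^ k) n))).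
    by rewrite mulnA dvdn_mulr.
  by rewrite -coprime_modr nE coprime_modr coprimen1.
split; first by move: co_d; rewrite coprimeMr => /andP[].
apply: geom_surj_inv; first by rewrite expn_gt0 prime_gt0.
  by move: co_d; rewrite coprimeMr => /andP[].
move=> t; have [n] := surj (e * p ^ k * t)%N; rewrite mulnA => nE; exists n.
exact: modn_mulI nE.
Qed.

Lemma frobX_card : phi ^+ f = 1.
Proof. by apply/permP=> x; rewrite frobpermX -cardF perm1 expf_card. Qed.

Lemma index_dvd_geom : (k %| f)%N -> (d %| e * (p ^ k * geom (p ^ k) (f %/ k)))%N.
Proof.
move=> kf; set n := (f %/ k)%N.
have nAphi : phi ^+ k \in 'N(A).
  by apply: (subsetP (normal_norm mulperm_normal)); exact: frobX_GammaL1.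
have [u Au gE] := mulgX_rcoset _ [group of A] (a ^+ e) (phi ^+ k) n (mem_cycle _ _) nAphi.
have : (a ^+ e * phi ^+ k) ^+ n \in A :&: H.
  by rewrite inE {1}gE -expgM mulnC divnK // frobX_card mulg1 Au groupX.
rewrite defAH => /cycleP[m]; rewrite -expgM => /(congr1 (fun g : {perm F} => g 1%R)).
by rewrite mulfrobX1 mulpermX1 => /unit_gen_mod; rewrite modnMr => /eqP.
Qed.

End GammaL1Theory.

(** * Transitive subgroups: semidirect structure and converse *)

Section Transitivity.
Variables (F : finFieldType) (w : {unit F}) (p f : nat) (chF : p \in [pchar F]%R).
Hypotheses (gen_w : generator [set: {unit F}] w) (f_gt0 : (0 < f)%N).
Hypothesis cardF : #|F| = (p ^ f)%N.
Local Notation a := (mulperm w).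
Local Notation phi := (frobperm chF).
Local Notation A := <[a]>.
Local Notation Gam := (GammaL1 w chF).

Lemma norm_cycle_mulperm b g : b \in A -> g \in Gam -> <[g]> \subset 'N(<[b]>).
Proof.
move=> Ab Gg; rewrite cycle_subG.
apply: (subsetP (normal_norm (char_normal_trans _ (mulperm_normal _ w _ chF)))) => //.
by rewrite sub_cyclic_char ?cycle_cyclic // cycle_subG.
Qed.

(** An element of the join is [b ^+ i * u * phi ^+ (k * n)] with [u] in the [sigma]-part of [A]. If
    it lies in [A], its Frobenius factor lies in [A :&: <[phi]> = 1], so it is in the [sigma]-part,
    which has order coprime to that of the [sigma^']-part. *)
Lemma GammaL1_TI_part (sigma : nat_pred) (b c : {perm F}) k :
    b \in cyclic_part A sigma -> c \in cyclic_part A sigma ->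
  cyclic_part A sigma^' :&: (<[b]> <*> <[c * phi ^+ k]>) = 1.
Proof.
move=> Ab Ac.
have [sPA cardP] : cyclic_part A sigma \subset A /\
    #|cyclic_part A sigma| = (#|A|`_sigma)%N by exact: cyclic_partP (cycle_cyclic a).
have [sPA' cardP'] : cyclic_part A sigma^' \subset A /\
    #|cyclic_part A sigma^'| = (#|A|`_sigma^')%N by exact: cyclic_partP (cycle_cyclic a).
have nPhi i : phi ^+ i \in 'N(cyclic_part A sigma).
  have nPG := cyclic_part_norm _ _ sigma (cycle_cyclic a) _ (mulperm_normal _ w _ chF).
  by apply: (subsetP nPG); exact: frobX_GammaL1.
have Gc : c \in Gam.
  by rewrite (subsetP (normal_sub (mulperm_normal _ w _ chF))) ?(subsetP sPA).
apply/trivgP; rewrite /= norm_joinEr; last first.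
  by rewrite norm_cycle_mulperm ?groupM ?frobX_GammaL1 ?(subsetP sPA).
have co_P : coprime #|cyclic_part A sigma^'| #|cyclic_part A sigma|.
  by rewrite cardP cardP' coprime_sym coprime_partC.
rewrite -(coprime_TIg co_P).
rewrite subsetI subsetIl /=; apply/subsetP=> z /setIP[Pz].
case/mulsgP=> b' g /cycleP[i ->] /cycleP[n ->] zE.
have [u Pu gE] := mulgX_rcoset _ _ c (phi ^+ k) n Ac (nPhi k).
have bP : b ^+ i \in cyclic_part A sigma by rewrite groupX.
have gP : phi ^+ k ^+ n \in A.
  rewrite -(groupMl _ (subsetP sPA _ Pu)) -gE -(groupMl _ (subsetP sPA _ bP)) -zE.
  exact: (subsetP sPA').
have : phi ^+ k ^+ n \in A :&: <[phi]> by rewrite inE gP -expgM mem_cycle.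
rewrite mulperm_frob_TI => /set1P g1.
by rewrite zE gE g1 mulg1 groupM.
Qed.

Variable H : {group {perm F}}.
Hypothesis sHG : H \subset Gam.

(** The projection of [H] to [<[phi]>] along [A] is [<[phi]> :&: (A * H)]; [phi ^+ k] generates it,
    and [a ^+ e] corrects this generator to an element of [H]. *)
Lemma GammaL1_generators : exists d e k,
  [/\ (d %| #[a])%N, A :&: H = <[a ^+ d]>, (k %| f)%N, a ^+ e * phi ^+ k \in H
    & forall h, h \in H -> exists n, exists2 y, y \in A & h = y * phi ^+ k ^+ n].
Proof.
have [d d_dv defAH] := sub_cycleX _ a (A :&: H)%G (subsetIl _ _).
have [k k_dv defK] := sub_cycleX _ phi (<[phi]> :&: (A <*> H))%G (subsetIl _ _).
have nAH : H \subset 'N(A) := subset_trans sHG (normal_norm (mulperm_normal _ w _ chF)).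
have {}defK : <[phi]> :&: (A * H) = <[phi ^+ k]> by rewrite -norm_joinEr.
have /setIP[_ /mulsgP[y h /cycleP[i yE] Hh kE]] : phi ^+ k \in <[phi]> :&: (A * H).
  by rewrite defK cycle_id.
have [e eE] : exists e, y^-1 = a ^+ e.
  by apply/cycleP; rewrite groupV yE mem_cycle.
exists d, e, k; split=> //.
- apply: dvdn_trans k_dv _; rewrite order_dvdn; apply/eqP.
  exact: (frobX_card _ _ chF _ cardF).
- by rewrite kE -eE mulKg.
move=> g Hg; have := subsetP sHG g Hg.
rewrite -(sdprodW (GammaL1_sdprod w chF)) => /mulsgP[y' z Ay' Pz gE].
have : z \in <[phi]> :&: (A * H).
  by rewrite inE Pz; apply/mulsgP; exists y'^-1 g; rewrite ?groupV // gE mulKg.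
by rewrite defK => /cycleP[n zE]; exists n, y'; rewrite // gE zE.
Qed.

(** Take for [b] and [c] the [sigma]-constituents of [a ^+ d] and of [a ^+ e0], where [sigma] is the
    set of primes of [d]. *)
Lemma transitive_GammaL1_structure :
  [transitive H, on GammaL1_dom F | 'P] ->
  exists (k : nat) (sigma : nat_pred) (b c : {perm F}),
    [/\ (k %| f)%N,
        {subset sigma <= [predI \pi(p ^ k - 1) & \pi(f)]},
        b \in cyclic_part A sigma /\ generator (cyclic_part A sigma) c,
        (2 \in sigma -> p ^ k = 3 %[mod 4] -> #[b]`_2 = #[a]`_2 %/ 2)%N
      & cyclic_part A sigma^' ><| (<[b]> * <[c * phi ^+ k]>) = H].
Proof.
move=> trH; have [d [e0 [k [d_dv defAH kf Hg0 genH]]]] := GammaL1_generators.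
have p_pr : prime p := pcharf_prime chF.
have d_gt0 : (0 < d)%N := dvdn_gt0 (order_gt0 a) d_dv.
have k_gt0 : (0 < k)%N := dvdn_gt0 f_gt0 kf.
have cycA : cyclic A := cycle_cyclic a.
have nAG := mulperm_normal _ w _ chF.
have order_ad : #[a ^+ d] = (#[a] %/ d)%N by rewrite orderXdiv.
pose sigma : nat_pred := \pi(d).
have [sP'A cardP'] : cyclic_part A sigma^' \subset A /\
    #|cyclic_part A sigma^'| = (#|A|`_sigma^')%N by exact: cyclic_partP.
have [sPA cardP] : cyclic_part A sigma \subset A /\
    #|cyclic_part A sigma| = (#|A|`_sigma)%N by exact: cyclic_partP.
have sP'H : cyclic_part A sigma^' \subset H.
  apply: subset_trans (subsetIr A H); rewrite defAH.
  rewrite -(cardSg_cyclic cycA) ?cycleX // cardP' -!orderE order_ad.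
  exact: partn_dvd_div.
have consttC' (x : {perm F}) : x.`_sigma^' * x.`_sigma = x.
  by rewrite -(consttNK sigma x) consttC.
have Ac : (a ^+ e0).`_sigma \in cyclic_part A sigma.
  by apply: constt_cyclic_part => //; apply: mem_cycle.
have [e cE] : exists e, (a ^+ e0).`_sigma = a ^+ e.
  by apply/cycleP; apply: (subsetP sPA).
rewrite cE in Ac.
(* Passing from [a ^+ e0] to its [sigma]-constituent removes only a factor from the [sigma^']-part
   of [A], which is contained in [H]. *)
have Hg : a ^+ e * phi ^+ k \in H.
  have Hc : (a ^+ e0).`_sigma^' \in H.
    by apply: (subsetP sP'H); apply: constt_cyclic_part => //; apply: mem_cycle.
  by rewrite -cE -(groupMl _ Hc) mulgA consttC'.
have Ab : (a ^+ d).`_sigma \in cyclic_part A sigma.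
  by apply: constt_cyclic_part => //; apply: mem_cycle.
set g := a ^+ e * phi ^+ k in Hg.
have nAphi : phi ^+ k \in 'N(A).
  by rewrite (subsetP (normal_norm nAG)) ?frobX_GammaL1.
have decH h : h \in H ->
    exists n, exists2 y, y \in <[a ^+ d]> & h = g ^+ n * y.
  move=> Hh; have [n [y Ay hE]] := genH h Hh.
  exists n, (g ^- n * h); last by rewrite mulKVg.
  rewrite -defAH inE andbC groupM ?groupV ?groupX //=.
  have [u Au gE] := mulgX_rcoset _ [group of A] _ _ n (mem_cycle a e) nAphi.
  rewrite gE hE (_ : _ * _ = (u^-1 * y) ^ (phi ^+ k ^+ n)); last first.
    by rewrite conjgE invMg !mulgA.
  have nAn : phi ^+ k ^+ n \in 'N(A) by rewrite groupX.
  by rewrite (memJ_norm _ nAn) groupM // groupV.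
have [co_de dl] := transitive_full_cycle _ _ _ _ gen_w _ _ _ _ sHG d_dv decH trH.
exists k, sigma, (a ^+ d).`_sigma, (a ^+ e); split=> //.
- move=> r; rewrite inE mem_primes => /and3P[r_pr _ rd].
  have l1 := dl.1 r r_pr rd; rewrite inE /= !mem_primes r_pr f_gt0 /=.
  have pk_gt1 : (1 < p ^ k)%N.
    by rewrite -(expn0 p) ltn_exp2l ?prime_gt1.
  rewrite subn_gt0 pk_gt1 -eqn_mod_dvd ?(ltnW pk_gt1) // l1 eqxx /=.
  have := index_dvd_geom _ _ _ chF _ _ _ _ _ cardF d_dv defAH Hg kf.
  rewrite mulnA Gauss_dvdr; last first.
    by rewrite coprimeMr co_de coprime_full_cycle_ratio.
  (* Modulo [r] the ratio is 1, so the sum of [f %/ k] terms is [f %/ k]. *)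
  move/(dvdn_trans rd); rewrite /dvdn (geom_mod1 _ _ _ l1) -/(dvdn _ _) => rfk.
  exact: dvdn_trans rfk (dvdn_div kf).
- by split=> //; apply: (generator_constt_part _ _ _ d).
- rewrite inE mem_primes => /and3P[_ _ d2] l3.
  have d4 : ~~ (4 %| d)%N by apply/negP=> /dl.2; rewrite l3.
  (* As [d] is even but not divisible by 4, the 2-part of [#[a] %/ d], which is that of [#[b]], is
     half of that of [#[a]]. *)
  have dpart : (d`_2 = 2)%N.
    have /dvdnP[d' dE] := d2; rewrite dE in d4 *.
    rewrite partnM //; last by move: d_gt0; rewrite dE; case: (d').
    rewrite part_p'nat ?part_pnat_id ?mul1n // p'natE //.
    by apply: contra d4 => d'2; rewrite (@dvdn_mul 2 2).
  rewrite order_constt partn_part; last first.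
    by move=> r /eqP->; rewrite inE mem_primes d_gt0.
  have N_gt0 : (0 < #[a] %/ d)%N.
    by rewrite (divn_gt0 _ d_gt0); apply: dvdn_leq (order_gt0 a) d_dv.
  have := partnM (2 : nat_pred) N_gt0 d_gt0; rewrite (divnK d_dv) => ->.
  by rewrite order_ad dpart mulnK.
have nBg : <[g]> \subset 'N(<[(a ^+ d).`_sigma]>).
  by rewrite norm_cycle_mulperm ?(subsetP sHG) ?(subsetP sPA).
rewrite -norm_joinEr // sdprodE; first last.
- exact: GammaL1_TI_part.
- apply: subset_trans (cyclic_part_norm _ _ _ cycA _ nAG).
  rewrite join_subG !cycle_subG (subsetP sHG _ Hg) andbT.
  by apply: (subsetP (normal_sub nAG)); apply: (subsetP sPA).
have Hb : (a ^+ d).`_sigma \in H.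
  have : (a ^+ d).`_sigma \in A :&: H by rewrite defAH cycle_constt.
  by case/setIP.
apply/eqP; rewrite eqEsubset mul_subG ?join_subG ?cycle_subG ?sP'H ?Hb //=.
(* Decomposing the inverse of [h] puts the factor from [A] on the left of the power of [g], the
   order required by the product. *)
apply/subsetP=> h /groupVr/decH[n [y /cycleP[m yE] hE]].
rewrite -(invgK h) hE invMg yE -(consttC' (a ^+ d ^- m)) -mulgA.
have -> : (a ^+ d ^- m).`_sigma = (a ^+ d).`_sigma ^- m by rewrite consttV consttX.
rewrite mem_mulg //.
  by apply: constt_cyclic_part => //; rewrite groupV !groupX // cycle_id.
by apply: groupM; rewrite groupV groupX // mem_gen // inE cycle_id ?orbT.
Qed.

(** As [H] contains the [sigma^']-part of [A], the index [d] of [A :&: H] in [A] divides the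
    [sigma]-part of [#[a]], so its primes lie in [sigma]. The generator [c] yields [coprime d e],
    and the condition on [b] handles the case modulo 4. *)
Lemma structure_transitive_GammaL1 k (sigma : nat_pred) (b c : {perm F}) :
    (k %| f)%N -> {subset sigma <= \pi(p ^ k - 1)} ->
    b \in cyclic_part A sigma -> generator (cyclic_part A sigma) c ->
    (2 \in sigma -> p ^ k = 3 %[mod 4] -> #[b]`_2 = #[a]`_2 %/ 2)%N ->
    cyclic_part A sigma^' ><| (<[b]> * <[c * phi ^+ k]>) = H ->
  [transitive H, on GammaL1_dom F | 'P].
Proof.
move=> kf sub_sigma Ab gen_c part2 /sdprodW defH.
have p_pr : prime p := pcharf_prime chF.
have cycA : cyclic A := cycle_cyclic a.
have N_gt0 : (0 < #[a])%N := order_gt0 a.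
have k_gt0 : (0 < k)%N := dvdn_gt0 f_gt0 kf.
have [sP'A cardP'] : cyclic_part A sigma^' \subset A /\
    #|cyclic_part A sigma^'| = (#|A|`_sigma^')%N by exact: cyclic_partP.
have [sPA cardP] : cyclic_part A sigma \subset A /\
    #|cyclic_part A sigma| = (#|A|`_sigma)%N by exact: cyclic_partP.
have Ac : c \in A.
  by apply: (subsetP sPA); rewrite (eqP gen_c) cycle_id.
have [e cE] : exists e, c = a ^+ e by apply/cycleP.
have sP'H : cyclic_part A sigma^' \subset H.
  rewrite -defH; apply/subsetP=> x P'x; rewrite -(mulg1 x) mem_mulg //.
  by rewrite -(mulg1 1) mem_mulg ?group1.
have sQH : <[b]> * <[c * phi ^+ k]> \subset H by rewrite -defH mulG_subr.
have Hb : b \in H.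
  by apply: (subsetP sQH); apply: (subsetP (mulG_subl _ _)); apply: cycle_id.
have Hg : a ^+ e * phi ^+ k \in H.
  rewrite -cE; apply: (subsetP sQH).
  by apply: (subsetP (mulG_subr _ _)); apply: cycle_id.
have [d d_dv defAH] := sub_cycleX _ a (A :&: H)%G (subsetIl _ _).
rewrite /= in defAH.
have d_gt0 : (0 < d)%N := dvdn_gt0 N_gt0 d_dv.
have cardAH : #|A :&: H| = (#[a] %/ d)%N by rewrite defAH -orderE orderXdiv.
have dN_sigma : (d %| #[a]`_sigma)%N.
  have sP'AH : cyclic_part A sigma^' \subset A :&: H by rewrite subsetI sP'A.
  have := cardSg sP'AH; rewrite cardP' cardAH -orderE (dvdn_divRL _ d_dv).
  by rewrite -{2}(partnC sigma N_gt0) mulnC dvdn_pmul2r ?part_gt0.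
have sigma_d r : prime r -> (r %| d)%N -> r \in sigma.
  move=> r_pr rd; apply: (pnatPpi (part_pnat sigma #[a])).
  by rewrite mem_primes r_pr part_gt0 (dvdn_trans rd).
have pk_gt1 : (1 < p ^ k)%N by rewrite -(expn0 p) ltn_exp2l ?prime_gt1.
have l1 r : r \in sigma -> p ^ k = 1 %[mod r].
  move/sub_sigma; rewrite mem_primes => /and3P[_ _].
  by rewrite -eqn_mod_dvd ?(ltnW pk_gt1) // => /eqP.
apply: (transitive_of_full_cycle _ _ _ _ gen_w _ _ _ _ _ cardF sHG d_dv defAH Hg) => //.
  (* The order of [c = a ^+ e] forces [gcdn #[a] e] to be the [sigma^']-part of [#[a]], which is
     coprime to [d]. *)
  have : (#[c] = #[a]`_sigma)%N by rewrite orderE -(eqP gen_c) cardP.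
  rewrite cE orderXgcd => /(congr1 (muln^~ (gcdn #[a] e))).
  rewrite /= divnK ?dvdn_gcdl // -{1}(partnC sigma N_gt0) => /eqP.
  rewrite eqn_pmul2l ?part_gt0 // => /eqP gE.
  have : coprime d (gcdn #[a] e).
    by rewrite -gE; apply: coprime_dvdl dN_sigma _; apply: coprime_partC.
  by rewrite /coprime gcdnA (gcdn_idPl d_dv).
split=> [r r_pr rd | d4]; first exact/l1/sigma_d.
have d2 : (2 %| d)%N by apply: dvdn_trans d4.
have s2 : 2 \in sigma by apply: sigma_d.
have odd_pk := l1 2 s2; apply/eqP/negPn/negP=> l4.
have l3 := odd_mod4 _ odd_pk l4.
have b2 := part2 s2 l3.
(* Since [b] lies in [A :&: H], half the 2-part of [#[a]] would divide the 2-part of [#[a] %/ d],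
   which is at most a quarter of it when [4] divides [d]. *)
have : (#[b]`_2 %| (#[a] %/ d)`_2)%N.
  rewrite partn_dvd //; first by rewrite -cardAH cardG_gt0.
  by rewrite -cardAH order_dvdG // inE (subsetP sPA).
have /dvdnP[t tE] : (4 %| d`_2)%N.
  by have := partn_dvd (2 : nat_pred) d_gt0 d4; rewrite (p_part 2 4).
have Nd_gt0 : (0 < #[a] %/ d)%N.
  by rewrite (divn_gt0 _ d_gt0); apply: dvdn_leq N_gt0 d_dv.
have := partnM (2 : nat_pred) Nd_gt0 d_gt0; rewrite (divnK d_dv) b2 tE => ->.
have := part_gt0 (2 : nat_pred) d; have := part_gt0 (2 : nat_pred) (#[a] %/ d).
by rewrite tE => x_gt0 t_gt0; apply/negP; apply: half_mul4_ndvd.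
Qed.

End Transitivity.

Theorem theorem2p3 (p f : nat) (F : finFieldType) (w : {unit F})
    (p_pr : prime p) (f_gt0 : (0 < f)%N) (cardF : #|F| = (p ^ f)%N)
    (gen_w : generator [set: {unit F}] w)
    (H : {group {perm F}}) :
  let chF := card_finPcharP cardF p_pr in
  let a := mulperm w in
  let phi := frobperm chF in
  H \subset GammaL1 w chF ->
  [transitive H, on GammaL1_dom F | 'P] <->
  exists (k : nat) (sigma : nat_pred) (b c : {perm F}),
    [/\ (k %| f)%N,
        {subset sigma <= [predI \pi(p ^ k - 1) & \pi(f)]},
        b \in cyclic_part <[a]> sigma /\
          generator (cyclic_part <[a]> sigma) c,
        (2 \in sigma -> p ^ k = 3 %[mod 4] -> #[b]`_2 = #[a]`_2 %/ 2)%N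
      & cyclic_part <[a]> sigma^' ><| (<[b]> * <[c * phi ^+ k]>) = H].
Proof.
move=> chF a phi sHG; split; first exact: transitive_GammaL1_structure.
case=> k [sigma [b [c [kf sub_sigma [Pb gen_c] part2 defH]]]].
apply: structure_transitive_GammaL1 kf _ Pb gen_c part2 defH => // r.
by case/sub_sigma/andP.
Qed.
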